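(* Let $\mathbb T=\{z\in\mathbb C:|z|=1\}$, and let $a_1,a_2\in\mathbb C$ be distinct points such that $a_1,a_2\notin\mathbb T$ and $a_1,a_2$ are not inverse points with respect to $\mathbb T$ (that is, $\overline{a_1}a_2\ne 1$). Then there exists a unique central conic $\mathcal D$ with foci $a_1$ and $a_2$ such that $(\mathbb T,\mathcal D)$ is a $3$-Poncelet pair. Moreover: (a) if $|a_1|<1$ and $|a_2|<1$, or if $|a_1|>1$ and $|a_2|>1$, then $\mathcal D$ is an ellipse; (b) if $|a_1|<1$ and $|a_2|>1$, then $\mathcal D$ is a hyperbola. In both cases, the length of the major axis (of the transverse axis, in the hyperbolic case) of $\mathcal D$ is $|1-\overline{a_1}a_2|$.
   Context: The plane is identified with $\mathbb C$. A central conic is an ellipse or a hyperbola in the real plane. The pair $(\mathcal C,\mathcal D)$ of conics is an $n$-Poncelet pair if, viewing the conics in $\mathbb{CP}^2$, there is a closed $n$-gon (with $n$ distinct vertices and $n$ distinct side lines) inscribed in $\mathcal C$ (vertices on $\mathcal C$) and circumscribed about $\mathcal D$ (each side line, i.e. the line through two consecutive vertices, is tangent to $\mathcal D$). *)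

(* Defs.v *)
From mathcomp Require Import all_boot all_order all_algebra.
From mathcomp Require Import boolp classical_sets reals.
From mathcomp Require Import complex.

Set Implicit Arguments.
Unset Strict Implicit.
Unset Printing Implicit Defensive.

Import Order.TTheory GRing.Theory Num.Theory.

Local Open Scope classical_set_scope.
Local Open Scope complex_scope.
Local Open Scope ring_scope.

(** The real plane is [R[i]], and real conics are sets of points of it. *)

Definition unit_circle (R : realType) : set R[i] := [set z | `|z| = 1].
Arguments unit_circle : clear implicits.

(** In [is_ellipse] and [is_hyperbola], [L] is the length of the major
    (transverse) axis.  The order of [R[i]] only compares numbers that differ by
    a real, so the inequalities force [L] to be a positive real. *)

Definition is_ellipse (R : realType) (f1 f2 L : R[i]) (D : set R[i]) : Prop :=
  `|f1 - f2| < L /\ D = [set z | `|z - f1| + `|z - f2| = L].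

Definition is_hyperbola (R : realType) (f1 f2 L : R[i]) (D : set R[i]) : Prop :=
  [/\ 0 < L, L < `|f1 - f2| & D = [set z | `| `|z - f1| - `|z - f2| | = L]].

Definition is_central_conic (R : realType) (f1 f2 : R[i]) (D : set R[i]) : Prop :=
  exists L : R[i], is_ellipse f1 f2 L D \/ is_hyperbola f1 f2 L D.

(** Points of the complex projective plane are nonzero vectors of ['rV_3] up to
    scaling and lines are row spaces of rank 2; in both cases equality is
    equality of row spaces, [(_ == _)%MS]. *)

Definition affine_point (R : realType) (z : R[i]) : 'rV[R]_3 :=
  \row_j [:: complex.Re z; complex.Im z; 1]`_j.

Definition on_conic (K : fieldType) (M : 'M[K]_3) (x : 'rV[K]_3) : Prop :=
  x *m M *m x^T = 0.

(** The line of all [y] with [y *m M *m x^T = 0] is the tangent at the point [x]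
    of the nondegenerate conic [M]. *)

Definition tangent_line (K : fieldType) (M : 'M[K]_3) (x : 'rV[K]_3) : 'M[K]_3 :=
  kermx (M *m x^T).

Definition is_tangent (K : fieldType) (M : 'M[K]_3) (l : 'M[K]_3) : Prop :=
  exists x : 'rV[K]_3, [/\ x != 0, on_conic M x & (l == tangent_line M x)%MS].

(** [M] is the matrix of an equation of the real conic [D].  For an ellipse or a
    hyperbola it is unique up to a real scalar. *)

Definition conic_equation (R : realType) (M : 'M[R]_3) (D : set R[i]) : Prop :=
  [/\ M^T = M, M \in unitmx & D = [set z | on_conic M (affine_point z)]].

Definition complexify (R : realType) (M : 'M[R]_3) : 'M[R[i]]_3 :=
  map_mx (real_complex R) M.

(** [ordS] is the cyclic successor, so that side [i] joins vertices [i] and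
    [i + 1 mod n]. *)

Definition side (K : fieldType) (n : nat) (p : 'I_n -> 'rV[K]_3) (i : 'I_n) :
    'M[K]_3 :=
  (p i + p (ordS i))%MS.

Definition is_polygon (K : fieldType) (n : nat) (p : 'I_n -> 'rV[K]_3) : Prop :=
  [/\ forall i, p i != 0,
      forall i j, i != j -> ~~ (p i == p j)%MS
    & forall i j, i != j -> ~~ (side p i == side p j)%MS].

Definition poncelet_pair (R : realType) (n : nat) (C D : set R[i]) : Prop :=
  exists M N : 'M[R]_3,
  [/\ conic_equation M C, conic_equation N D
    & exists p : 'I_n -> 'rV[R[i]]_3,
      [/\ is_polygon p,
          forall i, on_conic (complexify M) (p i)
        & forall i, is_tangent (complexify N) (side p i)]].

(* Main.v *)
(** In the isotropic coordinates [z = x + i y], [w = x - i y] the circle is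
    [z w = 1], with points [(t, 1 / t)], and the chord joining [s] and [t] is
    [z + s t w = s + t].  The product of the (signed) distances from the two
    foci to a tangent of the conic is constant, so with [b_i] the conjugate of
    [a_i] and [mu = L^2 - |a1 - a2|^2] this chord is tangent to the conic iff
      [(a1 + b1 s t - (s + t)) (a2 + b2 s t - (s + t)) = mu s t].
    For a triangle [t1, t2, t3], Vieta's formulas at each vertex show that the
    [t_i] are the roots of
      [X (X - a1) (X - a2) = lambda (1 - b1 X) (1 - b2 X)], [lambda = t1 t2 t3],
    and comparing coefficients gives [mu = (1 - a1 b1) (1 - a2 b2)], that is
    [L = |1 - b1 a2|].  Conversely, for this [mu] the roots of the cubic form a
    Poncelet triangle for every [lambda <> 0] for which they are distinct. *)
Require Import Defs.
From mathcomp Require Import all_boot all_order all_algebra ring lra.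
From mathcomp Require Import boolp classical_sets reals.
From mathcomp Require Import complex.

Set Implicit Arguments.
Unset Strict Implicit.
Unset Printing Implicit Defensive.

Import Order.TTheory GRing.Theory Num.Theory.

Local Open Scope classical_set_scope.
Local Open Scope complex_scope.
Local Open Scope ring_scope.

(** * The tangency relation between chords and its cubic *)

(** Vanishes iff the line [p z + q w + r = 0] is tangent to the conic. *)
Definition chord_form (F : fieldType) (a1 b1 a2 b2 mu p r q : F) : F :=
  (a1 * p + b1 * q + r) * (a2 * p + b2 * q + r) - mu * (p * q).

Definition chord_eq (F : fieldType) (a1 b1 a2 b2 mu s t : F) : Prop :=
  chord_form a1 b1 a2 b2 mu 1 (- (s + t)) (s * t) = 0.

(** Two rounds of divided differences: cancelling the nonzero differences of the roots eliminates
    first [c0], then [c1]. *)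
Lemma cubic_coefs (F : fieldType) (t1 t2 t3 c0 c1 c2 : F) :
  t1 != t2 -> t1 != t3 -> t2 != t3 ->
  (forall t, t \in [:: t1; t2; t3] -> t ^+ 3 + c2 * t ^+ 2 + c1 * t + c0 = 0) ->
  c2 = - (t1 + t2 + t3) /\ c1 = t1 * t2 + t1 * t3 + t2 * t3.
Proof.
move=> n12 n13 n23 h.
have h1 : t1 ^+ 3 + c2 * t1 ^+ 2 + c1 * t1 + c0 = 0 by apply: h; rewrite !inE eqxx.
have h2 : t2 ^+ 3 + c2 * t2 ^+ 2 + c1 * t2 + c0 = 0 by apply: h; rewrite !inE eqxx orbT.
have h3 : t3 ^+ 3 + c2 * t3 ^+ 2 + c1 * t3 + c0 = 0 by apply: h; rewrite !inE eqxx !orbT.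
rewrite -subr_eq0 in n12; rewrite -subr_eq0 in n13; rewrite -subr_eq0 in n23.
have q12 : t1 ^+ 2 + t1 * t2 + t2 ^+ 2 + c2 * (t1 + t2) + c1 = 0.
  apply: (mulfI n12); rewrite mulr0 -[RHS](subrr 0) -{1}h1 -h2; ring.
have q13 : t1 ^+ 2 + t1 * t3 + t3 ^+ 2 + c2 * (t1 + t3) + c1 = 0.
  apply: (mulfI n13); rewrite mulr0 -[RHS](subrr 0) -{1}h1 -h3; ring.
have l : t1 + t2 + t3 + c2 = 0.
  apply: (mulfI n23); rewrite mulr0 -[RHS](subrr 0) -{1}q12 -q13; ring.
have c2E : c2 = - (t1 + t2 + t3) by apply/eqP; rewrite -addr_eq0 addrC l.
split=> //; apply/eqP; rewrite -subr_eq0 -q12 c2E; apply/eqP; ring.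
Qed.

Lemma chord_triangle_mu (F : fieldType) (a1 b1 a2 b2 mu t1 t2 t3 : F) :
  t1 != t2 -> t1 != t3 -> t2 != t3 ->
  chord_eq a1 b1 a2 b2 mu t1 t2 -> chord_eq a1 b1 a2 b2 mu t1 t3 ->
  chord_eq a1 b1 a2 b2 mu t2 t3 ->
  mu = (1 - a1 * b1) * (1 - a2 * b2).
Proof.
rewrite /chord_eq /chord_form => n12 n13 n23 h12 h13 h23.
pose al t := (b1 * t - 1) * (b2 * t - 1); pose ga t := (a1 - t) * (a2 - t).
pose be t := (b1 * t - 1) * (a2 - t) + (b2 * t - 1) * (a1 - t) - mu * t.
(* The far ends of the two tangent chords through [t] are the roots of
   [al t X^2 + be t X + ga t]. *)
have vieta t s r : s != r ->
    chord_eq a1 b1 a2 b2 mu s t -> chord_eq a1 b1 a2 b2 mu r t ->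
    al t * (s + r) = - be t /\ al t * (s * r) = ga t.
  rewrite -subr_eq0 /chord_eq /chord_form => nsr hs hr.
  have lin : al t * (s + r) + be t = 0.
    by apply: (mulfI nsr); rewrite mulr0 -[RHS](subrr 0) -{1}hs -hr /al /be; ring.
  have linE : al t * (s + r) = - be t by apply/eqP; rewrite -addr_eq0 lin.
  split=> //; apply/eqP; rewrite -subr_eq0 -[_ == 0]eqr_opp oppr0.
  have -> : - (al t * (s * r) - ga t) =
    (al t * s ^+ 2 + be t * s + ga t) - s * (al t * (s + r) + be t) by ring.
  by rewrite lin mulr0 subr0 -hs /al /be /ga; apply/eqP; ring.
have sym s t : chord_eq a1 b1 a2 b2 mu s t -> chord_eq a1 b1 a2 b2 mu t s.
  by rewrite /chord_eq addrC mulrC.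
have [s1 p1] := vieta t1 t2 t3 n23 (sym _ _ h12) (sym _ _ h13).
have [s2 p2] := vieta t2 t1 t3 n13 h12 (sym _ _ h23).
have [s3 p3] := vieta t3 t1 t2 n12 h13 h23.
pose e3 := t1 * t2 * t3.
have cub t : t \in [:: t1; t2; t3] -> al t * e3 = t * ga t.
  by rewrite /e3 !inE => /or3P [] /eqP ->; rewrite -(p1, p2, p3); ring.
have [c2E c1E] : - (a1 + a2) - e3 * b1 * b2 = - (t1 + t2 + t3) /\
    a1 * a2 + e3 * (b1 + b2) = t1 * t2 + t1 * t3 + t2 * t3.
  apply: (@cubic_coefs _ t1 t2 t3 (- e3)) => // t /cub h.
  by rewrite -(subrr (t * ga t)) -{2}h /ga /al; ring.
have e1E : t1 + t2 + t3 = a1 + a2 + e3 * b1 * b2.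
  by apply: oppr_inj; rewrite -c2E; ring.
(* The cubic gives the sum of the other two vertices, and Vieta at [t] gives [al t] times that sum
   in terms of [mu]; comparing the two leaves a factor [t]. *)
have key t s r : t + s + r = t1 + t2 + t3 -> al t * (s + r) = - be t ->
    al t * e3 = t * ga t -> mu * t = (1 - a1 * b1) * (1 - a2 * b2) * t.
  move=> e1 hs hc; have sE : s + r = a1 + a2 + e3 * b1 * b2 - t by rewrite -e1E -e1; ring.
  have -> : mu * t = - be t + be t + mu * t by ring.
  rewrite -{1}hs sE.
  have -> : al t * (a1 + a2 + e3 * b1 * b2 - t) =
    al t * (a1 + a2 - t) + b1 * b2 * (al t * e3) by ring.
  by rewrite hc /al /be /ga; ring.
(* At most one vertex is [0], so the factor [t1] or [t2] can be cancelled. *)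
have [t10|t10] := eqVneq t1 0; last first.
  by apply: (mulIf t10); apply: (key t1 t2 t3) => //; apply: cub; rewrite !inE eqxx.
have t20 : t2 != 0 by rewrite -t10 eq_sym.
apply: (mulIf t20); apply: (key t2 t1 t3) => //; first by ring.
by apply: cub; rewrite !inE eqxx orbT.
Qed.

(** The coefficient identities make [t3] a root of the cubic. Hence the quadratic for the far ends
    of the tangent chords through [t3] is [al * (X - t1) * (X - t2)], with [t1] among its roots. *)
Lemma chord_eq_cubic (F : fieldType) (a1 b1 a2 b2 t1 t2 t3 : F) :
  let e3 := t1 * t2 * t3 in e3 != 0 ->
  t1 + t2 + t3 = a1 + a2 + e3 * (b1 * b2) ->
  t1 * t2 + t1 * t3 + t2 * t3 = a1 * a2 + e3 * (b1 + b2) ->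
  chord_eq a1 b1 a2 b2 ((1 - a1 * b1) * (1 - a2 * b2)) t1 t3.
Proof.
move=> e3 e30 h1 h2.
have t30 : t3 != 0 by apply: contraNneq e30 => t30; rewrite /e3 t30 mulr0.
pose al := (b1 * t3 - 1) * (b2 * t3 - 1); pose ga := (a1 - t3) * (a2 - t3).
have cub : al * e3 = t3 * ga.
  have -> : al * e3 = t3 * ga - t3 ^+ 3
      + (a1 + a2 + e3 * (b1 * b2)) * t3 ^+ 2
      - (a1 * a2 + e3 * (b1 + b2)) * t3 + e3 by rewrite /al /ga; ring.
  by rewrite -h1 -h2 /e3; ring.
have prd : al * (t1 * t2) = ga.
  by apply: (mulfI t30); rewrite -cub /e3; ring.
have sm : al * (t1 + t2) = al * (a1 + a2 - t3) + b1 * b2 * (t3 * ga).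
  rewrite -cub.
  have -> : t1 + t2 = a1 + a2 + e3 * (b1 * b2) - t3 by rewrite -h1; ring.
  ring.
rewrite /chord_eq /chord_form.
transitivity (al * t1 ^+ 2 - (al * (a1 + a2 - t3) + b1 * b2 * (t3 * ga)) * t1 + ga).
  by rewrite /al /ga; ring.
by rewrite -sm -prd; ring.
Qed.

(** * Existence of a cubic with three distinct roots *)

(** Pigeonhole on the naturals, which are distinct in characteristic 0. *)
Lemma exists_notin (R : numDomainType) (s : seq R) : exists x, x \notin s.
Proof.
have [|/allPn [x _ xs]] := boolP (all [in s] [seq n%:R | n <- iota 0 (size s).+1]);
  last by exists x.
move=> /allP /uniq_leq_size; rewrite size_map size_iota ltnn.
by move=> h; exfalso; apply: notF; apply: h; rewrite map_inj_uniq ?iota_uniq //;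
   exact/mulrIn/oner_neq0.
Qed.

(** The [t_i] are the roots of [A = lam * B]. The four inequalities rule out a common zero of [A]
    and [B], and a double root is a critical point of [A / B], which happens for finitely many [lam]
    only. *)
Lemma exists_triangle (C : numClosedFieldType) (a1 b1 a2 b2 : C) :
  a1 != a2 -> a1 * b1 != 1 -> a1 * b2 != 1 -> a2 * b1 != 1 -> a2 * b2 != 1 ->
  exists t1 t2 t3 : C, let e3 := t1 * t2 * t3 in
  [/\ [/\ t1 != t2, t1 != t3 & t2 != t3], e3 != 0,
      t1 + t2 + t3 = a1 + a2 + e3 * (b1 * b2)
    & t1 * t2 + t1 * t3 + t2 * t3 = a1 * a2 + e3 * (b1 + b2)].
Proof.
move=> na n11 n12 n21 n22.
pose A (x : C) := x * (x - a1) * (x - a2); pose B (x : C) := (1 - b1 * x) * (1 - b2 * x).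
(* [W] is the numerator of the derivative of [A / B]: avoiding its values at
   the zeros of [W] makes the fiber of [A / B] consist of distinct points. *)
pose W : {poly C} := (3 *: 'X^2 - (2 * (a1 + a2)) *: 'X + (a1 * a2)%:P) *
    ((1 - b1 *: 'X) * (1 - b2 *: 'X)) -
  'X * ('X - a1%:P) * ('X - a2%:P) * ((2 * b1 * b2) *: 'X - (b1 + b2)%:P).
have WE x : W.[x] = (3 * x ^+ 2 - 2 * (a1 + a2) * x + a1 * a2) * B x
    - A x * (2 * b1 * b2 * x - (b1 + b2)) by rewrite /W !hornerE /A /B; ring.
(* At the zeros [a1] and [a2] of [A] only [A' B] survives, so [W = 0] would give
   [a1 (a1 - a2) = a2 (a2 - a1) = 0]. *)
have W0 : W != 0.
  apply: contraNneq na => W0.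
  have h1 : a1 * (a1 - a2) * ((1 - a1 * b1) * (1 - a1 * b2)) = 0.
    by transitivity W.[a1]; [rewrite WE /A /B; ring | rewrite W0 horner0].
  have h2 : a2 * (a2 - a1) * ((1 - a2 * b1) * (1 - a2 * b2)) = 0.
    by transitivity W.[a2]; [rewrite WE /A /B; ring | rewrite W0 horner0].
  move/eqP: h1; move/eqP: h2; rewrite !mulf_eq0 !subr_eq0 ![1 == _]eq_sym.
  rewrite (negPf n11) (negPf n12) (negPf n21) (negPf n22) /= !orbF.
  by move=> /orP [/eqP ->|/eqP -> //] /orP [/eqP ->|/eqP -> //].
have [rW WrE] := closed_field_poly_normal W.
(* The value [0] is excluded too, because [lam] becomes the product of the roots. *)
have [lam] := exists_notin (0 :: [seq A w / B w | w <- rW]).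
rewrite inE negb_or => /andP [lam0 lamW].
pose c1 := a1 * a2 + lam * (b1 + b2); pose c2 := - (a1 + a2 + lam * (b1 * b2)).
pose P : {poly C} := Poly [:: - lam; c1; c2; 1].
have PE : P = [:: - lam; c1; c2; 1] :> seq C by rewrite /P (@PolyK _ 1) //= oner_eq0.
have [r rE] := closed_field_poly_normal P.
have lP : lead_coef P = 1 by rewrite lead_coefE PE.
rewrite lP scale1r in rE.
have := congr1 (fun p : {poly C} => size p) rE.
rewrite PE /= size_prod_XsubC => -[].
case: r rE => [|t1 [|t2 [|t3 [|//]]]] //= rE _.
have ev x : (x - t1) * (x - t2) * (x - t3) = - lam + c1 * x + c2 * x ^+ 2 + x ^+ 3.
  have := congr1 (fun p => p.[x]) rE.
  rewrite horner_Poly /= !big_cons big_nil !hornerE /= => h.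
  by apply: etrans (etrans (esym h) _); rewrite /c1; ring.
have e3E : t1 * t2 * t3 = lam.
  apply: oppr_inj; transitivity ((0 - t1) * (0 - t2) * (0 - t3)); first by ring.
  by rewrite ev; ring.
have [c2E c1E] : c2 = - (t1 + t2 + t3) /\ c1 = t1 * t2 + t1 * t3 + t2 * t3.
  (* Adding the values at [1] and [-1] isolates [c2]; the value at [1] then yields [c1]. *)
  have p1 := ev 1; have p2 := ev (-1).
  have two : (2 : C) != 0 by rewrite pnatr_eq0.
  have s1 : c2 = - (t1 + t2 + t3).
    apply: (mulfI two).
    have -> : 2 * c2 = (- lam + c1 * 1 + c2 * 1 ^+ 2 + 1 ^+ 3)
       + (- lam + c1 * -1 + c2 * (-1) ^+ 2 + (-1) ^+ 3) + 2 * lam by ring.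
    by rewrite -p1 -p2 -e3E; ring.
  split=> //.
  have -> : c1 = (- lam + c1 * 1 + c2 * 1 ^+ 2 + 1 ^+ 3) + lam - c2 - 1 by ring.
  by rewrite -p1 s1 -e3E; ring.
(* Here [u] is a double root and [v] the remaining one: [A - lam * B] and its derivative vanish at
   [u], hence so does [W], and [lam] is an excluded value. *)
have nodup u v : 2 * u + v = t1 + t2 + t3 -> u * u + u * v + u * v = t1 * t2 + t1 * t3 + t2 * t3 ->
    u * u * v = t1 * t2 * t3 -> False.
  move=> d1 d2 d3.
  have AE : A u = lam * B u.
    rewrite -[LHS](addrNK (lam * B u)).
    have -> : A u - lam * B u = u ^+ 3 + c2 * u ^+ 2 + c1 * u - lam by rewrite /A /B /c1 /c2; ring.
    by rewrite c1E c2E -d1 -d2 -e3E -d3; ring.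
  have W0u : W.[u] = 0.
    have -> : W.[u] = (3 * u ^+ 2 + 2 * c2 * u + c1) * B u
        - (A u - lam * B u) * (2 * b1 * b2 * u - (b1 + b2)).
      by rewrite WE /A /B /c1 /c2; ring.
    by rewrite AE c1E c2E -d1 -d2; ring.
  (* A zero of [B] would also be a zero of [A], that is [0], [a1] or [a2], where [B] does not
     vanish. *)
  have Bu : B u != 0.
    apply: contraTneq isT => Bu.
    move/eqP: (AE); rewrite Bu mulr0 !mulf_eq0 !subr_eq0 => /orP [/orP [] |] /eqP uE.
    - by move: Bu; rewrite uE /B !mulr0 subr0 mulr1 => /eqP; rewrite oner_eq0.
    - move/eqP: Bu; rewrite uE mulf_eq0 !subr_eq0 ![1 == _]eq_sym ![_ * a1]mulrC.
      by rewrite (negPf n11) (negPf n12).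
    - move/eqP: Bu; rewrite uE mulf_eq0 !subr_eq0 ![1 == _]eq_sym ![_ * a2]mulrC.
      by rewrite (negPf n21) (negPf n22).
  case/mapP: lamW; exists u; last by rewrite AE mulfK.
  move/eqP: W0u; rewrite WrE hornerZ mulf_eq0 lead_coef_eq0 (negPf W0) /=.
  by rewrite -rootE root_prod_XsubC.
exists t1, t2, t3; split=> /=; rewrite ?e3E //.
- split; apply/eqP => e.
  + by apply: (nodup t1 t3); rewrite -e; ring.
  + by apply: (nodup t1 t2); rewrite -e; ring.
  + by apply: (nodup t2 t1); rewrite -e; ring.
- by apply: oppr_inj; rewrite -c2E.
Qed.

(** * Homogeneous coordinates of points and conics *)

Definition row3 (F : pzRingType) (x y t : F) : 'rV[F]_3 := \row_j [:: x; y; t]`_j.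

Lemma mulmx3E (F : pzRingType) m n (A : 'M[F]_(m, 3)) (B : 'M[F]_(3, n)) i j :
  (A *m B) i j = A i 0 * B 0 j + A i 1 * B 1 j + A i 2 * B 2 j.
Proof.
rewrite mxE !big_ord_recr big_ord0 /= add0r.
by congr (_ * _ + _ * _ + _ * _); congr (fun_of_matrix _ _ _); exact: val_inj.
Qed.

Lemma ord3P (P : 'I_3 -> Prop) : P 0 -> P 1 -> P 2 -> forall i, P i.
Proof.
move=> P0 P1 P2 [[|[|[|//]]] i3].
- by rewrite (_ : Ordinal i3 = 0) //; exact: val_inj.
- by rewrite (_ : Ordinal i3 = 1) //; exact: val_inj.
- by rewrite (_ : Ordinal i3 = 2) //; exact: val_inj.
Qed.

(** Any two vertices of a triangle are adjacent, so a symmetric relation can be checked on the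
    sides. *)
Lemma ord3_pairs (P : 'I_3 -> 'I_3 -> Prop) : (forall i j, P i j -> P j i) ->
  (forall i, P i (ordS i)) -> forall i j, i != j -> P i j.
Proof.
move=> Psym PS i j ij.
have [->|/eqP ji] := eqVneq j (ordS i); first exact: PS.
suff -> : i = ordS j by apply: Psym; apply: PS.
apply: val_inj; move: i j ij ji; do 2!apply: ord3P => //.
all: by move=> _ []; exact: val_inj.
Qed.

Lemma row3_eta (F : pzRingType) (p : 'rV[F]_3) : p = row3 (p 0 0) (p 0 1) (p 0 2).
Proof. by apply/rowP; apply: ord3P; rewrite !mxE. Qed.

Lemma row3_mul (F : pzRingType) (x y t : F) (n : 'cV[F]_3) :
  row3 x y t *m n = 0 <-> x * n 0 0 + y * n 1 0 + t * n 2 0 = 0.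
Proof.
split=> [/matrixP /(_ 0 0)|h]; first by rewrite mulmx3E !mxE.
by apply/matrixP => i j; rewrite !ord1 mulmx3E !mxE.
Qed.

Lemma on_conicE (F : fieldType) (M : 'M[F]_3) (x y t : F) :
  on_conic M (row3 x y t) <->
  M 0 0 * x ^+ 2 + M 1 1 * y ^+ 2 + M 2 2 * t ^+ 2 + (M 0 1 + M 1 0) * (x * y) +
    (M 0 2 + M 2 0) * (x * t) + (M 1 2 + M 2 1) * (y * t) = 0.
Proof.
have E : (row3 x y t *m M *m (row3 x y t)^T) 0 0 =
  M 0 0 * x ^+ 2 + M 1 1 * y ^+ 2 + M 2 2 * t ^+ 2 + (M 0 1 + M 1 0) * (x * y) +
    (M 0 2 + M 2 0) * (x * t) + (M 1 2 + M 2 1) * (y * t).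
  by rewrite !mulmx3E !mxE /=; ring.
split=> [/matrixP /(_ 0 0)|h]; first by rewrite E mxE.
by apply/matrixP => i j; rewrite !ord1 E h mxE.
Qed.

Lemma on_conic_diag (F : fieldType) (a b d x y t : F) :
  on_conic (diag_mx (row3 a b d)) (row3 x y t) <->
  a * x ^+ 2 + b * y ^+ 2 + d * t ^+ 2 = 0.
Proof. by rewrite on_conicE !mxE /= !(mulr0n, mulr1n, addr0, mul0r). Qed.

Lemma on_conicZ (F : fieldType) (M : 'M[F]_3) (k : F) (p : 'rV[F]_3) : k != 0 ->
  on_conic (k *: M) p <-> on_conic M p.
Proof.
rewrite /on_conic -scalemxAr -scalemxAl => k0; split=> [/eqP|->]; last by rewrite scaler0.
by rewrite scaler_eq0 (negPf k0) => /eqP.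
Qed.

Lemma quad_diag (F : fieldType) (m : 'cV[F]_3) (a b d : F) :
  (m^T *m diag_mx (row3 a b d) *m m) 0 0 =
  a * m 0 0 ^+ 2 + b * m 1 0 ^+ 2 + d * m 2 0 ^+ 2.
Proof. by rewrite !mulmx3E !mxE /= !(mulr0n, mulr1n); ring. Qed.

Lemma map_row3 (F : pzRingType) (F' : pzRingType) (h : {rmorphism F -> F'}) (x y t : F) :
  map_mx h (row3 x y t) = row3 (h x) (h y) (h t).
Proof. by apply/rowP; apply: ord3P; rewrite !mxE. Qed.

(** * Tangent lines and the dual conic *)

Section Tangents.
Variables (F : fieldType) (N Q : 'M[F]_3) (k : F).
Hypotheses (symN : N^T = N) (k0 : k != 0) (NQ : N *m Q = k%:M).

Let QN : Q *m N = k%:M.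
Proof.
have : N *m (k^-1 *: Q) = 1%:M.
  by rewrite -scalemxAr NQ scale_scalar_mx mulVf.
move/mulmx1C; rewrite -scalemxAl => h.
by rewrite -[Q *m N]scale1r -(mulfV k0) -scalerA h scale_scalar_mx mulr1.
Qed.

(** The tangent at [x] is the line [n = N *m x^T], and [n^T Q n = k x N x^T] vanishes: [n] lies on
    the dual conic [Q]. *)
Lemma tangent_dual (p q : 'rV[F]_3) : is_tangent N (p + q)%MS ->
  exists n : 'cV[F]_3, [/\ n != 0, p *m n = 0, q *m n = 0 & n^T *m Q *m n = 0].
Proof.
case=> x [x0 xN /eqmxP side]; exists (N *m x^T); split.
- apply: contraNneq x0 => Nx; rewrite -(inj_eq trmx_inj) trmx0.
  have : k *: x^T = 0 by rewrite -mul_scalar_mx -QN -mulmxA Nx mulmx0.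
  by move/eqP; rewrite scaler_eq0 (negPf k0).
- by apply/sub_kermxP; rewrite -side addsmxSl.
- by apply/sub_kermxP; rewrite -side addsmxSr.
- rewrite trmx_mul trmxK symN -!mulmxA [Q *m _]mulmxA QN mul_scalar_mx -!scalemxAr mulmxA.
  by rewrite [X in _ *: X]xN scaler0.
Qed.

(** The point of contact is the pole [Q *m n], which [N] sends back to a multiple of [n]; rank 2
    makes the side the whole line [n]. *)
Lemma dual_tangent (p q : 'rV[F]_3) (n : 'cV[F]_3) : Q^T = Q ->
  n != 0 -> p *m n = 0 -> q *m n = 0 -> n^T *m Q *m n = 0 ->
  \rank (p + q)%MS = 2 -> is_tangent N (p + q)%MS.
Proof.
move=> symQ n0 pn qn nQn r2; exists (Q *m n)^T.
have Nx : N *m (Q *m n) = k *: n by rewrite mulmxA NQ mul_scalar_mx.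
split.
- apply: contraNneq n0 => /(congr1 trmx); rewrite trmxK trmx0 => Qn.
  by move/eqP: Nx; rewrite Qn mulmx0 eq_sym scaler_eq0 (negPf k0).
- by rewrite /on_conic trmxK -mulmxA Nx trmx_mul symQ -scalemxAr nQn scaler0.
- rewrite /tangent_line trmxK Nx.
  have sub : (p + q <= kermx (k *: n))%MS.
    by rewrite addsmx_sub !sub_kermx -!scalemxAr pn qn scaler0 eqxx.
  rewrite -(geq_leqif (mxrank_leqif_eq sub)) mxrank_ker r2 mxrank_scale_nz //.
  by rewrite leq_subLR addnC -[3%N]/(2 + 1)%N leq_add2l lt0n mxrank_eq0.
Qed.

End Tangents.

(** * Rational parametrization of the circle *)

(** In isotropic coordinates this is the point [z = u / v], [w = v / u]. The homogeneous parameters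
    also reach the two circular points at infinity, at [u = 0] and [v = 0]. *)
Definition circle_point (F : fieldType) (i u v : F) : 'rV[F]_3 :=
  row3 (u ^+ 2 + v ^+ 2) (- i * (u ^+ 2 - v ^+ 2)) (2 * (u * v)).

Section CirclePoints.
Variables (F : fieldType) (i : F).
Hypotheses (i2 : i ^+ 2 = -1) (two : (2 : F) != 0).

(** With [w = x - i y] the circle is [(x + i y) w = t^2]. If [w] is nonzero, take [u / v = t / w];
    otherwise [t = 0] and the point is circular. *)
Lemma circle_param (p : 'rV[F]_3) : p != 0 -> on_conic (diag_mx (row3 1 1 (-1))) p ->
  exists s u v, p = s *: circle_point i u v /\ (v = 1 \/ (u = 1 /\ v = 0)).
Proof.
rewrite [p]row3_eta; move: (p 0 0) (p 0 1) (p 0 2) => x y t {p} p0.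
rewrite on_conic_diag => xyt.
have [w0|w0] := eqVneq (x - i * y) 0; last first.
  exists ((x - i * y) / 2), (t / (x - i * y)), 1; split; last by left.
  have tt : t ^+ 2 = (x + i * y) * (x - i * y).
    rewrite -[LHS]addr0 -xyt.
    have -> : (x + i * y) * (x - i * y) = x ^+ 2 - i ^+ 2 * y ^+ 2 by ring.
    by rewrite i2; ring.
  apply/rowP; apply: ord3P; rewrite !mxE /= ?expr_div_n ?tt.
  - by field; rewrite w0.
  - have -> : (x - i * y) / 2 * (- i * ((x + i * y) * (x - i * y) / (x - i * y) ^+ 2 - 1 ^+ 2))
       = - i ^+ 2 * y by field; rewrite w0.
    by rewrite i2; ring.
  - by field; rewrite w0.
have xE : x = i * y by apply/eqP; rewrite -subr_eq0 w0.
have t0 : t = 0.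
  apply/eqP; rewrite -sqrf_eq0 -oppr_eq0 -[X in _ == X]xyt xE exprMn i2.
  by apply/eqP; ring.
exists x, 1, 0; split; last by right.
apply/rowP; apply: ord3P; rewrite !mxE /= ?t0 ?xE; first by ring.
- have -> : i * y * (- i * (1 ^+ 2 - 0 ^+ 2)) = - i ^+ 2 * y by ring.
  by rewrite i2; ring.
- by ring.
Qed.

(* Up to a factor 2, the line [n] has the coefficients [p], [q], [r] in the
   coordinates [z = x + i y], [w = x - i y].  Both it and the chord are the
   cross product of the same two points, hence the two are proportional. *)
Lemma chord_coords (u1 v1 u2 v2 : F) (n : 'cV[F]_3) (Phi : F -> F -> F -> F) :
  (forall k p r q, Phi (k * p) (k * r) (k * q) = k ^+ 2 * Phi p r q) ->
  let p := n 0 0 - i * n 1 0 in let q := n 0 0 + i * n 1 0 in let r := 2 * n 2 0 in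
  n != 0 -> u1 * v2 != u2 * v1 ->
  circle_point i u1 v1 *m n = 0 -> circle_point i u2 v2 *m n = 0 ->
  Phi p r q = 0 -> Phi (v1 * v2) (- (u1 * v2 + u2 * v1)) (u1 * u2) = 0.
Proof.
move=> homPhi p q r n0; rewrite -subr_eq0 => d12 /row3_mul h1 /row3_mul h2 Phi0.
have e1 : p * u1 ^+ 2 + q * v1 ^+ 2 + r * (u1 * v1) = 0.
  by rewrite -h1 /p /q /r; ring.
have e2 : p * u2 ^+ 2 + q * v2 ^+ 2 + r * (u2 * v2) = 0.
  by rewrite -h2 /p /q /r; ring.
(* Eliminating between [e1] and [e2] gives each minor of the two coefficient vectors, multiplied by
   the nonzero determinant [d12]. *)
have pr : p * (- (u1 * v2 + u2 * v1)) = r * (v1 * v2).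
  apply/eqP; rewrite -subr_eq0; apply/eqP; apply: (mulfI d12); rewrite mulr0.
  transitivity ((p * u2 ^+ 2 + q * v2 ^+ 2 + r * (u2 * v2)) * v1 ^+ 2 -
    (p * u1 ^+ 2 + q * v1 ^+ 2 + r * (u1 * v1)) * v2 ^+ 2); first by ring.
  by rewrite e1 e2; ring.
have qr : q * (- (u1 * v2 + u2 * v1)) = r * (u1 * u2).
  apply/eqP; rewrite -subr_eq0; apply/eqP; apply: (mulfI d12); rewrite mulr0.
  transitivity ((p * u1 ^+ 2 + q * v1 ^+ 2 + r * (u1 * v1)) * u2 ^+ 2 -
    (p * u2 ^+ 2 + q * v2 ^+ 2 + r * (u2 * v2)) * u1 ^+ 2); first by ring.
  by rewrite e1 e2; ring.
have pq : p * (u1 * u2) = q * (v1 * v2).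
  apply/eqP; rewrite -subr_eq0; apply/eqP; apply: (mulfI d12); rewrite mulr0.
  transitivity ((p * u1 ^+ 2 + q * v1 ^+ 2 + r * (u1 * v1)) * (u2 * v2) -
    (p * u2 ^+ 2 + q * v2 ^+ 2 + r * (u2 * v2)) * (u1 * v1)); first by ring.
  by rewrite e1 e2; ring.
set P := v1 * v2 in pr qr pq *; set S := - _ in pr qr pq *; set T := u1 * u2 in pr qr pq *.
have main k l : k * P = l * p -> k * S = l * r -> k * T = l * q -> k != 0 -> Phi P S T = 0.
  move=> hP hS hT kn0; apply/eqP; move: (homPhi k P S T); rewrite hP hS hT homPhi Phi0 mulr0.
  by move/esym/eqP; rewrite mulf_eq0 sqrf_eq0 (negPf kn0).
(* The scaling factor is a nonzero one among [p], [q], [r]; they cannot all vanish since they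
   determine [n]. *)
have [p0|p0] := eqVneq p 0; last by apply: (main p P); rewrite // (pr, pq, mulrC) // mulrC.
have [q0|q0] := eqVneq q 0; last first.
  by apply: (main q T); rewrite // ?(qr, esym pq) // mulrC.
have [r0|r0] := eqVneq r 0; last by apply: (main r S); rewrite -?pr -?qr // mulrC.
case/eqP: n0; apply/colP.
have n00 : n 0 0 = 0.
  by apply: (mulfI two); rewrite mulr0 -[RHS](addr0 0) -{1}p0 -q0 /p /q; ring.
have n10 : n 1 0 = 0.
  move: p0; rewrite /p n00 sub0r => /eqP; rewrite oppr_eq0 mulf_eq0 => /orP [/eqP i0|/eqP //].
  by move/eqP: i2; rewrite i0 expr0n /= eq_sym oppr_eq0 oner_eq0.
have n20 : n 2 0 = 0 by apply: (mulfI two); rewrite mulr0.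
by apply: ord3P; rewrite mxE ?n00 ?n10 ?n20.
Qed.

End CirclePoints.

(** * Triangles in homogeneous parameters *)

Lemma chord_formC (F : fieldType) (a1 b1 a2 b2 mu u v u' v' : F) :
  chord_form a1 b1 a2 b2 mu (v * v') (- (u * v' + u' * v)) (u * u') =
  chord_form a1 b1 a2 b2 mu (v' * v) (- (u' * v + u * v')) (u' * u).
Proof. by rewrite [v * v']mulrC [u * u']mulrC [u * v' + _]addrC. Qed.

(** Exchanging [u] and [v] inverts [t = u / v] and swaps each [a_j] with [b_j], which preserves the
    value of [mu]. One of the two affine charts contains all three vertices. *)
Lemma chord_triangle_hom (F : fieldType) (a1 b1 a2 b2 mu : F) (u v : 'I_3 -> F) :
  (forall i j, i != j -> u i * v j != u j * v i) ->
  (forall i j, i != j ->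
     chord_form a1 b1 a2 b2 mu (v i * v j) (- (u i * v j + u j * v i)) (u i * u j) = 0) ->
  mu = (1 - a1 * b1) * (1 - a2 * b2).
Proof.
move=> uv chord.
have nz (w z : 'I_3 -> F) (c1 d1 c2 d2 : F) : (forall i, z i != 0) ->
    (forall i j, i != j -> w i * z j != w j * z i) ->
    (forall i j, i != j ->
      chord_form c1 d1 c2 d2 mu (z i * z j) (- (w i * z j + w j * z i)) (w i * w j) = 0) ->
    mu = (1 - c1 * d1) * (1 - c2 * d2).
  move=> z0 wz ch.
  have ne i j : i != j -> w i / z i != w j / z j.
    by move=> /wz; apply: contra; rewrite eqr_div // mulrC [w j * _]mulrC !(mulrC (z _)).
  have ceq i j : i != j -> chord_eq c1 d1 c2 d2 mu (w i / z i) (w j / z j).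
    move=> /ch h; have := z0 i; have := z0 j => zi zj; rewrite /chord_eq.
    transitivity ((z i * z j) ^- 2 * chord_form c1 d1 c2 d2 mu
      (z i * z j) (- (w i * z j + w j * z i)) (w i * w j)).
      by rewrite /chord_form; field; rewrite zi zj.
    by rewrite h mulr0.
  exact: (chord_triangle_mu (ne 0 1 isT) (ne 0 2 isT) (ne 1 2 isT)
    (ceq 0 1 isT) (ceq 0 2 isT) (ceq 1 2 isT)).
have [/existsP [i /eqP vi]|/existsPn v0] := boolP [exists i, v i == 0]; last exact: (nz u v).
(* The points with [v = 0] and with [u = 0] cannot both be vertices. *)
rewrite [a1 * b1]mulrC [a2 * b2]mulrC; apply: (nz v u).
- move=> j; apply/negP => /eqP uj.
  have ij : i != j.
    apply/eqP => ij; have i1 : i != i + 1 by move: (i); exact: ord3P.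
    by move: (uv _ _ i1); rewrite vi ij uj mul0r mulr0 eqxx.
  have := chord i j ij; rewrite /chord_form vi uj.
  (* The chord through the two circular points is the line at infinity, on which the form is a
     nonzero square. *)
  have -> : (a1 * (0 * v j) + b1 * (u i * 0) + - (u i * v j + 0 * 0)) *
    (a2 * (0 * v j) + b2 * (u i * 0) + - (u i * v j + 0 * 0)) -
    mu * (0 * v j * (u i * 0)) = (u i * v j) ^+ 2 by ring.
  move/eqP; rewrite sqrf_eq0 => uivj; have := uv i j ij.
  by rewrite (eqP uivj) uj mul0r eqxx.
- by move=> j l jl; rewrite mulrC [v l * _]mulrC eq_sym uv.
- by move=> j l jl; rewrite -(chord j l jl) /chord_form; ring.
Qed.

(** * Equations of conics with given foci *)

Section FocalConics.
Variable R : realType.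
Implicit Types (c f w z : R[i]) (g : R) (N : 'M[R]_3).

Definition similarity c f : 'M[R]_3 := \matrix_(i, j)
  (nth [::] [:: [:: complex.Re f; complex.Im f; 0];
                [:: - complex.Im f; complex.Re f; 0];
                [:: complex.Re c; complex.Im c; 1]] i)`_j.

(* Through [z = c + f w] the foci [c + f] and [c - f] become [1] and [-1], and the
   squared semi-axes of the conic become [g] and [g - 1],
   the latter negative for a hyperbola. *)
Definition focal_conic c f g : set R[i] :=
  [set z | (g - 1) * complex.Re ((z - c) / f) ^+ 2
           + g * complex.Im ((z - c) / f) ^+ 2 = g * (g - 1)].

(** The dual of [x^2 / g + y^2 / (g - 1) = 1] is [g X^2 + (g - 1) Y^2 = Z^2]; a line [n] of the
    original plane has the coordinates [similarity c f *m n] in the normalized one. *)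
Definition focal_dual c f g : 'M[R]_3 :=
  (similarity c f)^T *m diag_mx (row3 g (g - 1) (-1)) *m similarity c f.

Lemma affine_pointE z : affine_point z = row3 (complex.Re z) (complex.Im z) 1.
Proof. by []. Qed.

Lemma affine_similarity c f w :
  affine_point (c + f * w) = affine_point w *m similarity c f.
Proof.
by case: c f w => [c1 c2] [f1 f2] [w1 w2]; apply/rowP; apply: ord3P;
  rewrite mulmx3E !mxE /=; ring.
Qed.

Lemma similarityM c f c' f' :
  similarity c' f' *m similarity c f = similarity (c + f * c') (f * f').
Proof.
case: c f c' f' => [c1 c2] [f1 f2] [d1 d2] [e1 e2]; apply/matrixP.
by apply: ord3P; apply: ord3P; rewrite mulmx3E !mxE /=; ring.
Qed.

Lemma similarity1 : similarity 0 1 = 1%:M.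
Proof.
by apply/matrixP; apply: ord3P; apply: ord3P; rewrite !mxE /= ?oppr0.
Qed.

Lemma similarity_unit c f : f != 0 -> similarity c f \in unitmx.
Proof.
move=> f0; suff /mulmx1_unit [] : similarity (- c / f) f^-1 *m similarity c f = 1%:M by [].
by rewrite similarityM mulfV // mulrC divfK // subrr similarity1.
Qed.

(* The real points [(+-a, 0)] and [(+-x, +-y)] determine a conic. *)
Lemma conic_axes N (a x y : R) : N^T = N -> a != 0 -> x != 0 -> y != 0 ->
  (forall s, s \in [:: 1; -1] -> on_conic N (row3 (s * a) 0 1)) ->
  (forall s t, s \in [:: 1; -1] -> t \in [:: 1; -1] -> on_conic N (row3 (s * x) (t * y) 1)) ->
  N = N 0 0 *: diag_mx (row3 1 ((a ^+ 2 - x ^+ 2) / y ^+ 2) (- a ^+ 2)).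
Proof.
move=> symN a0 x0 y0 ha hxy.
have sym i j : N i j = N j i by rewrite -[in LHS]symN mxE.
have p1 : 1 \in [:: 1; -1 : R] by rewrite inE eqxx.
have m1 : -1 \in [:: 1; -1 : R] by rewrite !inE eqxx orbT.
have two : (2 : R) != 0 by rewrite pnatr_eq0.
have /on_conicE := ha _ p1; have /on_conicE := ha _ m1.
have /on_conicE := hxy _ _ p1 p1; have /on_conicE := hxy _ _ p1 m1.
have /on_conicE := hxy _ _ m1 p1; have /on_conicE := hxy _ _ m1 m1.
rewrite (sym 1 0) (sym 2 0) (sym 2 1) => e1 e2 e3 e4 e5 e6.
have N02 : N 0 2 = 0 by apply: (mulIf a0); lra.
have N22 : N 2 2 = - a ^+ 2 * N 0 0 by lra.
have N12 : N 1 2 = 0 by apply: (mulIf y0); lra.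
have N01 : N 0 1 = 0 by apply: (mulIf (mulf_neq0 x0 y0)); lra.
have N11 : N 1 1 * y ^+ 2 = (a ^+ 2 - x ^+ 2) * N 0 0 by lra.
have {}N11 : N 1 1 = N 0 0 * ((a ^+ 2 - x ^+ 2) / y ^+ 2).
  by apply: (mulIf (expf_neq0 2 y0)); rewrite N11; field.
apply/matrixP; apply: ord3P; apply: ord3P; rewrite !mxE /= ?(sym 1 0, sym 2 0, sym 2 1)
  ?(N01, N02, N12) ?(mulr0n, mulr1n, mulr0, mulr1) //.
by rewrite N22; ring.
Qed.

Lemma row3_similarity c f N (x y : R) :
  on_conic (similarity c f *m N *m (similarity c f)^T) (row3 x y 1) <->
  on_conic N (affine_point (c + f * (x +i* y))).
Proof.
by rewrite /on_conic affine_similarity affine_pointE /= !trmx_mul !mulmxA.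
Qed.

Lemma unit_circle_equation N : conic_equation N (unit_circle R) ->
  exists2 k, k != 0 & N = k *: diag_mx (row3 1 1 (-1)).
Proof.
case=> symN Nu DE.
have onN (x y : R) : x ^+ 2 + y ^+ 2 = 1 -> on_conic N (row3 x y 1).
  move=> xy; have : unit_circle R (x +i* y) by rewrite /unit_circle /= normc_def /= xy sqrtr1.
  by rewrite DE.
have pm (s : R) : s \in [:: 1; -1] -> s ^+ 2 = 1.
  by rewrite !inE => /orP [] /eqP ->; ring.
have nz (k : nat) : (k.+1%:R : R) != 0 by rewrite pnatr_eq0.
(* The triple 3, 4, 5 supplies rational points off the axes. *)
have NE := @conic_axes N 1 (3 / 5) (4 / 5) symN (oner_neq0 _) (mulf_neq0 (nz 2) (invr_neq0 (nz 4)))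
  (mulf_neq0 (nz 3) (invr_neq0 (nz 4))).
exists (N 0 0).
  apply: contraTneq Nu => N0; rewrite NE ?N0 ?scale0r; last 2 first.
  - by move=> s /pm hs; apply: onN; rewrite exprMn hs; field.
  - by move=> s t /pm hs /pm ht; apply: onN; rewrite !exprMn hs ht; field.
  by rewrite unitmxE det0 unitr0.
rewrite {1}NE; last 2 first.
- by move=> s /pm hs; apply: onN; rewrite exprMn hs; field.
- by move=> s t /pm hs /pm ht; apply: onN; rewrite !exprMn hs ht; field.
congr (_ *: diag_mx (row3 _ _ _)); first by field.
by ring.
Qed.

(** In normalized position, explicit real points force [N'] to be a multiple of the inverse of
    [diag (g, g - 1, -1)]; the similarity is then undone. *)
Lemma focal_conic_equation c f g N : f != 0 -> 0 < g -> g != 1 ->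
  conic_equation N (focal_conic c f g) ->
  exists2 k, k != 0 & N *m focal_dual c f g = k%:M.
Proof.
move=> f0 g0 g1 [symN Nu DE].
set T := similarity c f; have Tu : T \in unitmx := similarity_unit c f0.
pose N' := T *m N *m T^T.
have symN' : N'^T = N' by rewrite /N' !trmx_mul trmxK symN mulmxA.
have N'u : N' \in unitmx by rewrite !unitmx_mul unitmx_tr Tu Nu.
have onN (x y : R) : (g - 1) * x ^+ 2 + g * y ^+ 2 = g * (g - 1) -> on_conic N' (row3 x y 1).
  move=> xy; apply/row3_similarity.
  have : focal_conic c f g (c + f * (x +i* y)).
    by rewrite /focal_conic /=; set w := x +i* y; rewrite [c + _]addrC addrK mulrAC mulfV // mul1r.
  by rewrite DE.
have pm (s : R) : s \in [:: 1; -1] -> s ^+ 2 = 1.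
  by rewrite !inE => /orP [] /eqP ->; ring.
have nz (k : nat) : (k.+1%:R : R) != 0 by rewrite pnatr_eq0.
have a0 : Num.sqrt g != 0 by rewrite gt_eqF // sqrtr_gt0.
have a2 : Num.sqrt g ^+ 2 = g by rewrite sqr_sqrtr // ltW.
have gm0 : g - 1 != 0 by rewrite subr_eq0.
have N'E : N' = N' 0 0 *: diag_mx (row3 1 (g / (g - 1)) (- g)).
  (* The points off the axes come from [(3/5)^2 + (4/5)^2 = 1] for an ellipse and from
     [(5/4)^2 - (3/4)^2 = 1] for a hyperbola. *)
  have [g1lt|g1lt] := ltP 1 g.
    have b2 : Num.sqrt (g - 1) ^+ 2 = g - 1 by rewrite sqr_sqrtr // subr_ge0 ltW.
    have b0 : Num.sqrt (g - 1) != 0 by rewrite gt_eqF // sqrtr_gt0 subr_gt0.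
    rewrite {1}(@conic_axes N' (Num.sqrt g) (3 / 5 * Num.sqrt g) (4 / 5 * Num.sqrt (g - 1))) //.
    - by congr (_ *: diag_mx (row3 _ _ _)); rewrite ?exprMn ?a2 // b2; field.
    - by rewrite mulf_neq0 // mulf_neq0 // invr_neq0.
    - by rewrite mulf_neq0 // mulf_neq0 // invr_neq0.
    - by move=> s /pm hs; apply: onN; rewrite exprMn hs a2; ring.
    - by move=> s t /pm hs /pm ht; apply: onN; rewrite !exprMn hs ht a2 b2; field.
  have g1' : 0 < 1 - g by rewrite subr_gt0 lt_neqAle g1.
  have b2 : Num.sqrt (1 - g) ^+ 2 = 1 - g by rewrite sqr_sqrtr // ltW.
  have b0 : Num.sqrt (1 - g) != 0 by rewrite gt_eqF // sqrtr_gt0.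
  rewrite {1}(@conic_axes N' (Num.sqrt g) (5 / 4 * Num.sqrt g) (3 / 4 * Num.sqrt (1 - g))) //.
  - congr (_ *: diag_mx (row3 _ _ _)); rewrite ?exprMn ?a2 // b2.
    by field; rewrite gm0 -oppr_eq0 opprB.
  - by rewrite mulf_neq0 // mulf_neq0 // invr_neq0.
  - by rewrite mulf_neq0 // mulf_neq0 // invr_neq0.
  - by move=> s /pm hs; apply: onN; rewrite exprMn hs a2; ring.
  - by move=> s t /pm hs /pm ht; apply: onN; rewrite !exprMn hs ht a2 b2; field.
exists (N' 0 0 * g).
  rewrite mulf_neq0 ?(gt_eqF g0) //.
  by apply: contraTneq N'u => m0; rewrite N'E m0 scale0r unitmxE det0 unitr0.
have N'D : N' *m diag_mx (row3 g (g - 1) (-1)) = (N' 0 0 * g)%:M.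
  rewrite {1}N'E -scalemxAl mulmx_diag -scale_scalar_mx -diag_const_mx; congr (_ *: diag_mx _).
  by apply/rowP; apply: ord3P; rewrite !mxE /=; [ring|field|ring].
apply: (can_inj (mulKmx Tu)); rewrite scalar_mxC -N'D /focal_dual -/T /N'.
by rewrite !mulmxA.
Qed.

Lemma focal_dual_sym c f g : (focal_dual c f g)^T = focal_dual c f g.
Proof. by rewrite /focal_dual !trmx_mul trmxK tr_diag_mx mulmxA. Qed.

Lemma focal_dual_unit c f g : f != 0 -> 0 < g -> g != 1 -> focal_dual c f g \in unitmx.
Proof.
move=> f0 g0 g1; rewrite !unitmx_mul unitmx_tr similarity_unit // andbT /=.
rewrite unitmxE det_diag unitfE; apply/prodf_neq0 => i _; rewrite mxE.
by move: i; apply: ord3P; rewrite ?oppr_eq0 ?oner_eq0 ?subr_eq0 //= gt_eqF.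
Qed.

Lemma focal_dual_equation c f g : f != 0 -> 0 < g -> g != 1 ->
  conic_equation (invmx (focal_dual c f g)) (focal_conic c f g).
Proof.
move=> f0 g0 g1; have Qu := focal_dual_unit c f0 g0 g1.
split; first by rewrite trmx_inv focal_dual_sym.
  by rewrite unitmx_inv.
set T := similarity c f; have Tu : T \in unitmx := similarity_unit c f0.
have gn0 : g != 0 by rewrite gt_eqF.
have gm0 : g - 1 != 0 by rewrite subr_eq0.
(* In normalized position the inverse of the dual is the equation [x^2 / g + y^2 / (g - 1) = 1]. *)
have E : T *m invmx (focal_dual c f g) *m T^T = diag_mx (row3 g^-1 (g - 1)^-1 (-1)).
  set Q := focal_dual c f g in Qu *; set D := diag_mx _.
  have DD : diag_mx (row3 g (g - 1) (-1)) *m D = 1%:M.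
    rewrite mulmx_diag -diag_const_mx; congr diag_mx.
    by apply/rowP; apply: ord3P; rewrite !mxE /= ?mulfV // mulrNN mulr1.
  have QD : Q *m (invmx T *m D *m (invmx T)^T) = 1%:M.
    by rewrite /Q /focal_dual -/T -!mulmxA mulKVmx // (mulmxA (diag_mx _)) DD mul1mx
      trmx_inv mulmxV ?unitmx_tr.
  rewrite -[invmx Q]mulmx1 -QD mulKmx // -!mulmxA mulKVmx //.
  by rewrite trmx_inv mulVmx ?unitmx_tr // mulmx1.
apply/seteqP; split=> z; rewrite /focal_conic /=; move wE: ((z - c) / f) => w.
all: have -> : z = c + f * w by rewrite -wE mulrC divfK // addrC subrK.
all: case: w {wE} => x y /=; rewrite -row3_similarity -/T E on_conic_diag => h.
  have -> : g^-1 * x ^+ 2 + (g - 1)^-1 * y ^+ 2 + -1 * 1 ^+ 2 =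
     ((g - 1) * x ^+ 2 + g * y ^+ 2 - g * (g - 1)) / (g * (g - 1)) by field; rewrite gm0.
  by rewrite h subrr mul0r.
apply/eqP; rewrite -subr_eq0.
have -> : (g - 1) * x ^+ 2 + g * y ^+ 2 - g * (g - 1) =
  g * (g - 1) * (g^-1 * x ^+ 2 + (g - 1)^-1 * y ^+ 2 + -1 * 1 ^+ 2) by field; rewrite gm0.
by rewrite h mulr0.
Qed.

Lemma conjcE z : z^* = complex.Re z -i* complex.Im z.
Proof. by case: z => x y; rewrite -[LHS]/((x +i* y)^*)%R. Qed.

End FocalConics.

(** * Tangency and distances in terms of the foci *)

(** In normalized line coordinates the dual equation reads [(Z + X) (Z - X) = (g - 1) (X^2 + Y^2)],
    whose left side is the product of the values of the line at the foci [1] and [-1]. *)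
Lemma chord_form_foci (F : fieldType) (i cx cy fx fy g n0 n1 n2 : F) : i * i = -1 ->
  4 * (g * (fx * n0 + fy * n1) ^+ 2 + (g - 1) * (- fy * n0 + fx * n1) ^+ 2
       - (cx * n0 + cy * n1 + n2) ^+ 2) =
  - chord_form (cx + i * cy + (fx + i * fy)) (cx - i * cy + (fx - i * fy))
      (cx + i * cy - (fx + i * fy)) (cx - i * cy - (fx - i * fy))
      ((fx ^+ 2 + fy ^+ 2) * (4 * (g - 1)))
      (n0 - i * n1) (2 * n2) (n0 + i * n1).
Proof. by move=> i2; rewrite /chord_form; ring: i2. Qed.

Section FocalPoncelet.
Variable R : realType.
Implicit Types (c f w z L : R[i]) (g s : R) (D : set R[i]).
Local Notation I := ('i%C : R[i]).

(** This is [L^2 - |a1 - a2|^2] for [L = |f| s] and [g = s^2 / 4], as [|a1 - a2| = 2 |f|]. *)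
Definition focal_mu f g : R[i] := `|f| ^+ 2 * (4 * (g - 1))%:C.

Lemma focal_dual_form c f g (n : 'cV[R[i]]_3) :
  4 * (n^T *m complexify (focal_dual c f g) *m n) 0 0 =
  - chord_form (c + f) (c + f)^* (c - f) (c - f)^* (focal_mu f g)
      (n 0 0 - I * n 1 0) (2 * n 2 0) (n 0 0 + I * n 1 0).
Proof.
pose T := map_mx (real_complex R) (similarity c f).
have -> : n^T *m complexify (focal_dual c f g) *m n =
  (T *m n)^T *m map_mx (real_complex R) (diag_mx (row3 g (g - 1) (-1))) *m (T *m n).
  by rewrite /complexify /focal_dual !map_mxM -map_trmx trmx_mul !mulmxA.
have EcJ z : z^* = (complex.Re z)%:C - I * (complex.Im z)%:C.
  by rewrite conjcE [LHS]complexE /= rmorphN mulrN.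
have m0 : (T *m n) 0 0 = (complex.Re f)%:C * n 0 0 + (complex.Im f)%:C * n 1 0.
  by rewrite mulmx3E !mxE /= rmorph0 mul0r addr0.
have m1 : (T *m n) 1 0 = - (complex.Im f)%:C * n 0 0 + (complex.Re f)%:C * n 1 0.
  by rewrite mulmx3E !mxE /= rmorph0 mul0r addr0 rmorphN.
have m2 : (T *m n) 2 0 = (complex.Re c)%:C * n 0 0 + (complex.Im c)%:C * n 1 0 + n 2 0.
  by rewrite mulmx3E !mxE /= rmorph1 mul1r.
rewrite map_diag_mx map_row3 quad_diag m0 m1 m2 rmorphN rmorph1 rmorphB rmorph1 mulN1r.
have i2 : I * I = -1 by rewrite -expr2 sqr_i.
rewrite (chord_form_foci _ _ _ _ _ _ _ _ i2) /focal_mu -add_Re2_Im2.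
rewrite [in (c + f)^*]rmorphD [in (c - f)^*]rmorphB /= !EcJ -!complexE.
rewrite rmorphM rmorphB rmorph1 rmorph_nat.
by rewrite rmorphD !rmorphXn.
Qed.

(** The factor [r1 + r2 - s] belongs to the ellipse and the two middle ones to the branches of the
    hyperbola. The triangle inequalities, for foci at distance 2, tell which factors can vanish. *)
Lemma focal_distances x y s : let g := s ^+ 2 / 4 in
  let r1 := Num.sqrt ((x - 1) ^+ 2 + y ^+ 2) in
  let r2 := Num.sqrt ((x + 1) ^+ 2 + y ^+ 2) in
  [/\ 2 <= r1 + r2, r1 <= r2 + 2, r2 <= r1 + 2 &
   (r1 + r2 + s) * (r2 + s - r1) * (r1 + s - r2) * (r1 + r2 - s) =
   16 * ((g - 1) * x ^+ 2 + g * y ^+ 2 - g * (g - 1)) :> R].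
Proof.
move=> g r1 r2.
have r10 : 0 <= r1 := sqrtr_ge0 _; have r20 : 0 <= r2 := sqrtr_ge0 _.
have q1 : r1 ^+ 2 = (x - 1) ^+ 2 + y ^+ 2 by rewrite sqr_sqrtr // addr_ge0 ?sqr_ge0.
have q2 : r2 ^+ 2 = (x + 1) ^+ 2 + y ^+ 2 by rewrite sqr_sqrtr // addr_ge0 ?sqr_ge0.
have le1 : `|x - 1| <= r1 by rewrite -sqrtr_sqr ler_wsqrtr // lerDl sqr_ge0.
have le2 : `|x + 1| <= r2 by rewrite -sqrtr_sqr ler_wsqrtr // lerDl sqr_ge0.
have [le1a le1b] : 1 - x <= r1 /\ x - 1 <= r1.
  by split; apply: le_trans le1; rewrite ?ler_norm // distrC ler_norm.
have [le2a le2b] : x + 1 <= r2 /\ - x - 1 <= r2.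
  by split; apply: le_trans le2; rewrite ?ler_norm // -normrN opprD ler_norm.
split=> //; first by lra.
- by rewrite -(@ler_pXn2r _ 2) ?nnegrE // ?addr_ge0 // sqrrD q1 q2; lra.
- by rewrite -(@ler_pXn2r _ 2) ?nnegrE // ?addr_ge0 // sqrrD q1 q2; lra.
(* Heron's formula. *)
transitivity (4 * s ^+ 2 * r1 ^+ 2 - (s ^+ 2 + r1 ^+ 2 - r2 ^+ 2) ^+ 2); first by ring.
by rewrite q1 q2 /g; field.
Qed.

Lemma focal_conicE c f g z : focal_conic c f g z <->
  (g - 1) * complex.Re ((z - c) / f) ^+ 2 + g * complex.Im ((z - c) / f) ^+ 2
   - g * (g - 1) = 0.
Proof. by rewrite /focal_conic /=; split=> [->|/subr0_eq //]; rewrite subrr. Qed.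

Lemma focal_norms c f z : f != 0 -> let w := (z - c) / f in
  let x := complex.Re w in let y := complex.Im w in
  `|z - (c + f)| = `|f| * (Num.sqrt ((x - 1) ^+ 2 + y ^+ 2))%:C /\
  `|z - (c - f)| = `|f| * (Num.sqrt ((x + 1) ^+ 2 + y ^+ 2))%:C.
Proof.
move=> f0 w x y.
have zE : z = c + f * w by rewrite /w mulrC divfK // addrC subrK.
have wE : w = x +i* y by rewrite /x /y; case: (w).
have -> : z - (c + f) = f * (w - 1) by rewrite zE; ring.
have -> : z - (c - f) = f * (w + 1) by rewrite zE; ring.
by split; rewrite normrM [X in _ * X]normc_def wE;
  congr (_ * (Num.sqrt (_ ^+ 2 + _ ^+ 2))%:C); rewrite /= ?oppr0 addr0.
Qed.

(** For [s > 2] the triangle inequalities make every factor in [focal_distances] positive except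
    [r1 + r2 - s]. *)
Lemma ellipse_focal c f s D : f != 0 ->
  is_ellipse (c + f) (c - f) (`|f| * s%:C) D <->
  2 < s /\ D = focal_conic c f (s ^+ 2 / 4).
Proof.
move=> f0; have nf : 0 < `|f| by rewrite normr_gt0.
rewrite /is_ellipse.
have -> : `|c + f - (c - f)| = `|f| * 2%:C.
  have -> : c + f - (c - f) = f * 2 by ring.
  by rewrite normrM rmorph_nat normr_nat.
rewrite ltr_pM2l // ltcR.
suff DE : 2 < s -> [set z | `|z - (c + f)| + `|z - (c - f)| = `|f| * s%:C] =
    focal_conic c f (s ^+ 2 / 4) by split=> -[s2 ->]; split=> //; rewrite DE.
move=> s2; apply/seteqP; split=> z; rewrite focal_conicE //=;
  have [-> ->] := focal_norms c z f0;
  have [] := focal_distances (complex.Re ((z - c) / f)) (complex.Im ((z - c) / f)) s;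
  set r1 := Num.sqrt _; set r2 := Num.sqrt _; set q := _ - _ * (_ - 1) => ? ? ? prd.
- rewrite -mulrDr => /(mulfI (lt0r_neq0 nf)); rewrite -rmorphD => /complexI rs.
  by move: prd; rewrite rs subrr mulr0 => /esym /eqP; rewrite mulf_eq0 pnatr_eq0 => /eqP.
- move=> q0; move: prd; rewrite q0 mulr0 => /eqP.
  rewrite mulf_eq0 gt_eqF ?subr_eq0 /=; first by rewrite -mulrDr -rmorphD => /eqP ->.
  by rewrite !mulr_gt0 //; lra.
Qed.

(** For [0 < s < 2 <= r1 + r2] the outer factors in [focal_distances] are positive, and the middle
    ones give [|r1 - r2| = s]. *)
Lemma hyperbola_focal c f s D : f != 0 ->
  is_hyperbola (c + f) (c - f) (`|f| * s%:C) D <->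
  0 < s < 2 /\ D = focal_conic c f (s ^+ 2 / 4).
Proof.
move=> f0; have nf : 0 < `|f| by rewrite normr_gt0.
rewrite /is_hyperbola.
have -> : `|c + f - (c - f)| = `|f| * 2%:C.
  have -> : c + f - (c - f) = f * 2 by ring.
  by rewrite normrM rmorph_nat normr_nat.
rewrite ltr_pM2l // ltcR pmulr_rgt0 // ltcR.
suff DE : 0 < s < 2 -> [set z | `| `|z - (c + f)| - `|z - (c - f)| | = `|f| * s%:C] =
    focal_conic c f (s ^+ 2 / 4).
  split=> [[s0 s2 ->]|[/[dup] s02 /andP [s0 s2] ->]]; last by split=> //; rewrite DE.
  by rewrite s0 s2 DE // s0.
move=> /andP [s0 s2]; apply/seteqP; split=> z; rewrite focal_conicE //=;
  have [-> ->] := focal_norms c z f0;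
  have [] := focal_distances (complex.Re ((z - c) / f)) (complex.Im ((z - c) / f)) s;
  set r1 := Num.sqrt _; set r2 := Num.sqrt _; set q := _ - _ * (_ - 1) => ? ? ? prd.
- rewrite -mulrBr normrM normr_id => /(mulfI (lt0r_neq0 nf)).
  rewrite -rmorphB normc_def /= [0 ^+ 2]mul0r addr0 sqrtr_sqr => /complexI rs.
  have : (r2 + s - r1) * (r1 + s - r2) = 0.
    by rewrite -rs; case: (ger0P (r1 - r2)) => _; ring.
  move=> h; move: prd; rewrite -[_ * _ * (r1 + s - r2)]mulrA h mulr0 mul0r => /esym /eqP.
  by rewrite mulf_eq0 pnatr_eq0 => /eqP.
- move=> q0; move: prd; rewrite q0 mulr0 => /eqP.
  have pos1 : 0 < r1 + r2 + s by lra.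
  have pos2 : 0 < r1 + r2 - s by lra.
  rewrite !mulf_eq0 (gt_eqF pos1) (gt_eqF pos2) /=.
  rewrite orbF -mulrBr normrM normr_id -rmorphB [X in _ * X]normc_def /=.
  rewrite [0 ^+ 2]mul0r addr0 sqrtr_sqr => rs; congr (_ * _%:C); case/orP: rs => /eqP rs.
    by rewrite (_ : r1 - r2 = s) ?gtr0_norm //; lra.
  by rewrite distrC (_ : r2 - r1 = s) ?gtr0_norm //; lra.
Qed.

Lemma pos_scaleE f L : f != 0 -> 0 < L -> exists s, L = `|f| * s%:C.
Proof.
move=> f0 L0; have nf : 0 < `|f| by rewrite normr_gt0.
exists (complex.Re (L / `|f|)); rewrite RRe_real; last by rewrite realE ltW // divr_gt0.
by rewrite mulrC divfK // lt0r_neq0.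
Qed.

Lemma central_conic_focal c f D : f != 0 ->
  is_central_conic (c + f) (c - f) D <->
  exists s, [/\ 0 < s, s != 2 & D = focal_conic c f (s ^+ 2 / 4)].
Proof.
move=> f0; split=> [[L]|[s [s0 s2 ->]]].
  have ell : is_ellipse (c + f) (c - f) L D -> 0 < L by case=> /(le_lt_trans (normr_ge0 _)).
  have hyp : is_hyperbola (c + f) (c - f) L D -> 0 < L by case.
  move=> LD; have L0 : 0 < L by case: LD.
  have [s LE] := pos_scaleE f0 L0; exists s; case: LD; rewrite LE.
    move/ellipse_focal => /(_ f0) [s2 ->]; split=> //; last by rewrite gt_eqF.
    exact: lt_trans s2.
  by move/hyperbola_focal => /(_ f0) [/andP [s0 s2] ->]; split=> //; rewrite lt_eqF.
exists (`|f| * s%:C); have [s2'|s2'] := ltP 2 s.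
  by left; apply/ellipse_focal.
by right; apply/hyperbola_focal => //; rewrite s0 lt_neqAle s2 s2'.
Qed.

End FocalPoncelet.

(** * Poncelet triangles between the circle and a focal conic *)

Section PonceletTriangles.
Variable R : realType.
Implicit Types (c f : R[i]) (g : R).
Local Notation I := ('i%C : R[i]).

Let II : I ^+ 2 = -1. Proof. exact: sqr_i. Qed.
Let two : (2 : R[i]) != 0. Proof. by rewrite pnatr_eq0. Qed.

Lemma complexify_diag (x y t : R) :
  complexify (diag_mx (row3 x y t)) = diag_mx (row3 x%:C y%:C t%:C).
Proof. by rewrite /complexify map_diag_mx map_row3. Qed.

(** Every side is a chord of the parametrized circle and lies on the dual conic, so the parameters
    of the vertices satisfy the tangency relation pairwise. *)
Lemma poncelet_focal_mu c f g : f != 0 -> 0 < g -> g != 1 ->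
  poncelet_pair 3 (unit_circle R) (focal_conic c f g) ->
  focal_mu f g = (1 - (c + f) * (c + f)^*) * (1 - (c - f) * (c - f)^*).
Proof.
move=> f0 g0 g1 [M [N [/unit_circle_equation [m m0 ->] Nconic [p [poly onM tan]]]]].
have [k k0 NQ] := focal_conic_equation f0 g0 g1 Nconic.
have cNQ : complexify N *m complexify (focal_dual c f g) = (k%:C)%:M.
  by rewrite /complexify -map_mxM NQ map_scalar_mx.
have symN : (complexify N)^T = complexify N by case: Nconic => symN _ _; rewrite map_trmx symN.
have kC0 : k%:C != 0 by rewrite fmorph_eq0.
have [pn0 pne _] := poly.
have param i : exists w : R[i] * R[i] * R[i], p i = w.1.1 *: circle_point I w.1.2 w.2 /\
     (w.2 = 1 \/ (w.1.2 = 1 /\ w.2 = 0)).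
  have onp : on_conic (diag_mx (row3 1 1 (-1))) (p i).
    have mC0 : m%:C != 0 by rewrite fmorph_eq0.
    apply/(on_conicZ _ _ mC0); have := onM i.
    by rewrite /complexify map_mxZ -/(complexify _) complexify_diag rmorphN !rmorph1.
  by have [s [u [v [-> h]]]] := circle_param II two (pn0 i) onp; exists (s, u, v).
have [w wE] := fin_all_exists param.
pose s i := (w i).1.1; pose u i := (w i).1.2; pose v i := (w i).2.
have pE i : p i = s i *: circle_point I (u i) (v i) by case: (wE i).
have vE i : v i = 1 \/ (u i = 1 /\ v i = 0) by case: (wE i).
have s0 i : s i != 0 by apply: contraNneq (pn0 i) => si; rewrite pE si scale0r.
(* The normalization in [circle_param] turns proportional parameters into equal ones, which would
   give the same vertex. *)
have uv i j : i != j -> u i * v j != u j * v i.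
  move=> /pne; apply: contraNneq => uvij.
  have [ui vi] : u i = u j /\ v i = v j.
    case: (vE i) (vE j) uvij => [->|[-> ->]] [->|[-> ->]] //.
    + by rewrite !mulr1.
    + by rewrite mulr0 mul1r => /esym /eqP; rewrite oner_eq0.
    + by rewrite mulr0 mul1r => /eqP; rewrite oner_eq0.
  apply/eqmxP; rewrite !pE ui vi.
  exact: eqmx_trans (eqmx_scale _ (s0 i)) (eqmx_sym (eqmx_scale _ (s0 j))).
apply: (chord_triangle_hom uv); apply: ord3_pairs => [i j <-|i]; first exact: chord_formC.
have [n [n0 pin pjn nQn]] := tangent_dual symN kC0 cNQ (tan i).
have iS : i != ordS i by move: i {pin pjn nQn}; exact: ord3P.
have on_n j : p j *m n = 0 -> circle_point I (u j) (v j) *m n = 0.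
  by rewrite pE -scalemxAl => /eqP; rewrite scaler_eq0 (negPf (s0 j)) => /eqP.
apply: (chord_coords (Phi := chord_form _ _ _ _ _) II two _ n0 (uv _ _ iS)
  (on_n _ pin) (on_n _ pjn)).
  by move=> a b d e; rewrite /chord_form; ring.
by apply: oppr_inj; rewrite -focal_dual_form nQn mxE mulr0 oppr0.
Qed.

(** The chord [z + t t' w = t + t'], written in the coordinates [x], [y]. *)
Definition chord_line (t t' : R[i]) : 'cV[R[i]]_3 :=
  (row3 (1 + t * t') (I * (1 - t * t')) (- (t + t')))^T.

Lemma chord_lineP (t t' u : R[i]) :
  circle_point I u 1 *m chord_line t t' = 0 <-> u = t \/ u = t'.
Proof.
rewrite row3_mul !mxE /=.
have -> : (u ^+ 2 + 1 ^+ 2) * (1 + t * t') + - I * (u ^+ 2 - 1 ^+ 2) * (I * (1 - t * t')) +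
    2 * (u * 1) * (- (t + t')) = 2 * ((u - t) * (u - t')).
  transitivity ((u ^+ 2 + 1) * (1 + t * t') - I ^+ 2 * (u ^+ 2 - 1) * (1 - t * t') -
    2 * u * (t + t')); first by ring.
  by rewrite II; ring.
split=> [/eqP|[] ->]; [|by ring|by ring].
by rewrite !mulf_eq0 (negPf two) !subr_eq0 /= => /orP [] /eqP ->; [left|right].
Qed.

Lemma circle_point_neq0 (u : R[i]) : circle_point I u 1 != 0.
Proof.
apply/eqP => /rowP h; have := h 0; have := h 2; rewrite !mxE /= mulr1 => /eqP.
rewrite mulf_eq0 (negPf two) => /eqP ->; rewrite expr0n expr1n add0r => /eqP.
by rewrite oner_eq0.
Qed.

(** The tangent [chord_line t t] meets the circle at [t] only. *)
Lemma circle_point_inj (u t : R[i]) :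
  (circle_point I u 1 <= circle_point I t 1)%MS -> u = t.
Proof.
move=> ut; suff /chord_lineP [] : circle_point I u 1 *m chord_line t t = 0 by [].
apply/sub_kermxP; apply: submx_trans ut _; apply/sub_kermxP.
by apply/chord_lineP; left.
Qed.

Lemma focal_mu_poncelet c f g : f != 0 -> 0 < g -> g != 1 ->
  (c + f) * (c + f)^* != 1 -> (c + f) * (c - f)^* != 1 ->
  (c - f) * (c + f)^* != 1 -> (c - f) * (c - f)^* != 1 ->
  focal_mu f g = (1 - (c + f) * (c + f)^*) * (1 - (c - f) * (c - f)^*) ->
  poncelet_pair 3 (unit_circle R) (focal_conic c f g).
Proof.
move=> f0 g0 g1 n11 n12 n21 n22 muE.
have ne : c + f != c - f.
  rewrite -subr_eq0; have -> : c + f - (c - f) = 2 * f by ring.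
  by rewrite mulf_neq0.
have [t1 [t2 [t3 [[t12 t13 t23] e30 s1 s2]]]] := exists_triangle ne n11 n12 n21 n22.
pose t (i : 'I_3) := [:: t1; t2; t3]`_i.
have tinj i j : i != j -> t i != t j.
  by move: i j; do 2!apply: ord3P => //; rewrite /t //= eq_sym.
have chord i : chord_eq (c + f) (c + f)^* (c - f) (c - f)^* (focal_mu f g) (t i) (t (ordS i)).
  rewrite muE; move: i; apply: ord3P; rewrite /t /=.
  (* [chord_eq_cubic] concerns its first and third roots, so each side needs its own ordering. *)
  - apply: (@chord_eq_cubic _ _ _ _ _ t1 t3 t2).
    + by rewrite mulrAC.
    + by rewrite [t1 * t3 * t2]mulrAC -s1; ring.
    + by rewrite [t1 * t3 * t2]mulrAC -s2; ring.
  - apply: (@chord_eq_cubic _ _ _ _ _ t2 t1 t3).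
    + by rewrite [t2 * t1]mulrC.
    + by rewrite [t2 * t1]mulrC -s1; ring.
    + by rewrite [t2 * t1]mulrC -s2; ring.
  - have e3E : t3 * t2 * t1 = t1 * t2 * t3 by ring.
    apply: (@chord_eq_cubic _ _ _ _ _ t3 t2 t1); rewrite e3E // -?s1 -?s2; ring.
pose p i := circle_point I (t i) 1.
pose n i := chord_line (t i) (t (ordS i)).
have Qu := focal_dual_unit c f0 g0 g1.
have iS (i : 'I_3) : i != ordS i by move: i; exact: ord3P.
have pn i : p i *m n i = 0 by apply/chord_lineP; left.
have pSn i : p (ordS i) *m n i = 0 by apply/chord_lineP; right.
have sub_side i j : (p j <= side p i)%MS -> j = i \/ j = ordS i.
  move=> pj; have : p j *m n i = 0.
    by apply/sub_kermxP; apply: submx_trans pj _; rewrite addsmx_sub !sub_kermx pn pSn eqxx.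
  by move/chord_lineP => -[] tE; [left|right]; apply/eqP; apply: contraT => /tinj; rewrite tE eqxx.
have ple i j : (p i <= p j)%MS -> i = j.
  by move/circle_point_inj => tE; apply/eqP; apply: contraT => /tinj; rewrite tE eqxx.
exists (diag_mx (row3 1 1 (-1))), (invmx (focal_dual c f g)); split.
- split; first exact: tr_diag_mx.
    rewrite unitmxE det_diag unitfE; apply/prodf_neq0 => i _; rewrite mxE.
    by move: i; apply: ord3P; rewrite ?oppr_eq0 ?oner_eq0.
  apply/seteqP; split=> z; rewrite /unit_circle /= affine_pointE on_conic_diag normc_def.
    move/complexI => h.
    have : complex.Re z ^+ 2 + complex.Im z ^+ 2 = 1.
      by rewrite -(sqr_sqrtr (addr_ge0 (sqr_ge0 (complex.Re z)) (sqr_ge0 (complex.Im z)))) h expr1n.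
    by move=> h1; rewrite !mul1r h1 expr1n mulr1 subrr.
  rewrite !mul1r expr1n mulr1 => /subr0_eq ->; by rewrite sqrtr1.
- exact: focal_dual_equation.
- exists p; split.
  + split=> [i|i j|i j].
    * exact: circle_point_neq0.
    * by apply: contra => /andP [/ple -> _].
    (* If the sides agree, vertices [j] and [j + 1] both lie on side [i], whose only vertices are
       [i] and [i + 1]; modulo 3 this forces [j = i]. *)
    * apply: contra => /andP [_ ji].
      have hj : (p j <= side p i)%MS by apply: submx_trans ji; exact: addsmxSl.
      have hS : (p (ordS j) <= side p i)%MS by apply: submx_trans ji; exact: addsmxSr.
      move: (sub_side _ _ hj) (sub_side _ _ hS); move: i j {ji hj hS}.
      by do 2!apply: ord3P => //; move=> [] // + [].
  + move=> i; rewrite complexify_diag rmorphN !rmorph1 on_conic_diag /p.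
    transitivity ((t i ^+ 2 + 1) ^+ 2 + I ^+ 2 * (t i ^+ 2 - 1) ^+ 2 - 4 * t i ^+ 2); first by ring.
    by rewrite II; ring.
  + move=> i; apply: (@dual_tangent _ _ (complexify (focal_dual c f g)) 1 _ _ _ _ (n i)) => //.
    * by rewrite oner_eq0.
    * by rewrite -map_mxM mulVmx // map_mx1.
    * by rewrite map_trmx focal_dual_sym.
    (* The first two coordinates vanish together only if [t t'] is both [-1] and [1]. *)
    * apply/eqP => /matrixP h; have := h 0 0; have := h 1 0; rewrite !mxE /= => /eqP.
      rewrite mulf_eq0 (_ : (I == 0) = false) /=; last first.
        by apply/eqP => i0; move: II; rewrite i0 expr0n /= => /esym /eqP; rewrite oppr_eq0 oner_eq0.
      by rewrite subr_eq0 => /eqP <- /eqP; rewrite (negPf two).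
    * apply/matrixP => a b; rewrite !ord1 [RHS]mxE.
      have four : (4 : R[i]) != 0 by rewrite pnatr_eq0.
      apply: (mulfI four); rewrite focal_dual_form mulr0.
      have := chord i; rewrite /chord_eq => ch.
      transitivity (- (4 * chord_form (c + f) (c + f)^* (c - f) (c - f)^* (focal_mu f g) 1
         (- (t i + t (ordS i))) (t i * t (ordS i)))); last by rewrite ch mulr0 oppr0.
      rewrite !mxE /=.
      have -> : 1 + t i * t (ordS i) - I * (I * (1 - t i * t (ordS i))) = 2.
        by rewrite mulrA -expr2 II; ring.
      have -> : 1 + t i * t (ordS i) + I * (I * (1 - t i * t (ordS i))) = 2 * (t i * t (ordS i)).
        by rewrite mulrA -expr2 II; ring.
      by rewrite /chord_form; ring.
    * have rp j : \rank (p j) = 1 by rewrite rank_rV circle_point_neq0.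
      apply/eqP; rewrite eqn_leq; apply/andP; split.
        by apply: leq_trans (mxrank_adds_leqif _ _) _; rewrite !rp.
      suff : (\rank (p i) < \rank (p i + p (ordS i))%MS)%N by rewrite rp.
      apply: rank_ltmx; rewrite /ltmx addsmxSl /=.
      by apply: contra (iS i); rewrite addsmx_sub => /andP [_ /ple ->].
Qed.

End PonceletTriangles.

(** * Uniqueness, existence and type of the conic *)

Theorem theorem2p3 (R : realType) (a1 a2 : R[i])
    (ha12 : a1 != a2)
    (ha1 : ~ unit_circle R a1) (ha2 : ~ unit_circle R a2)
    (hinv : a1^* * a2 != 1) :
  (exists! D : set R[i],
     is_central_conic a1 a2 D /\ poncelet_pair 3 (unit_circle R) D) /\
  (forall D : set R[i],
     is_central_conic a1 a2 D -> poncelet_pair 3 (unit_circle R) D ->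
     ((`|a1| < 1 /\ `|a2| < 1) \/ (1 < `|a1| /\ 1 < `|a2|) ->
        is_ellipse a1 a2 `|1 - a1^* * a2| D) /\
     (`|a1| < 1 /\ 1 < `|a2| ->
        is_hyperbola a1 a2 `|1 - a1^* * a2| D)).
Proof.
(* The center, and the vector from it to the focus [a1]. *)
pose c := (a1 + a2) / 2; pose f := (a1 - a2) / 2.
have a1E : a1 = c + f by rewrite /c /f; field.
have a2E : a2 = c - f by rewrite /c /f; field.
have f0 : f != 0 by rewrite mulf_neq0 ?subr_eq0 // invr_neq0 // pnatr_eq0.
have nf : 0 < `|f| by rewrite normr_gt0.
have norm2 (z : R[i]) : `|z| ^+ 2 = z * z^* := normCK z.
have unitE (a : R[i]) : ~ unit_circle R a -> a * a^* != 1.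
  move=> ha; apply: contra_notN ha => /eqP; rewrite -norm2 => h.
  by apply/eqP; rewrite /unit_circle /= -(@eqrXn2 _ 2) // h expr1n.
have n11 := unitE _ ha1; have n22 := unitE _ ha2.
have n21 : a2 * a1^* != 1 by rewrite mulrC.
have n12 : a1 * a2^* != 1.
  by apply: contra n21 => /eqP h; rewrite -[a2]conjCK -rmorphM mulrC h rmorph1.
pose L := `|1 - a1^* * a2|.
have L0 : 0 < L by rewrite normr_gt0 subr_eq0 eq_sym.
(* This identity turns the forced value of [mu] into the axis length [L]. *)
have L2 : L ^+ 2 = `|a1 - a2| ^+ 2 + (1 - a1 * a1^*) * (1 - a2 * a2^*).
  rewrite /L !norm2 ?(rmorphB, rmorphM, rmorph1, conjCK) /=.
  by rewrite ?(rmorphB, rmorphM, rmorph1, conjCK) /=; ring.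
have [s LE] := pos_scaleE f0 L0.
have s0 : 0 < s by move: L0; rewrite LE pmulr_rgt0 // ltcR.
have dE : `|a1 - a2| = `|f| * 2.
  by rewrite -(normr_nat R[i] 2) -normrM /f divfK // pnatr_eq0.
have muE (r : R) : focal_mu f (r ^+ 2 / 4) = (`|f| * r%:C) ^+ 2 - `|a1 - a2| ^+ 2.
  rewrite /focal_mu dE; have -> : 4 * (r ^+ 2 / 4 - 1) = r ^+ 2 - 4 :> R by field.
  by rewrite rmorphB rmorphXn rmorph_nat; ring.
have gE (r : R) : 0 < r -> r != 2 -> 0 < r ^+ 2 / 4 /\ r ^+ 2 / 4 != 1.
  move=> r0 r2; split; first by rewrite divr_gt0 // exprn_gt0.
  apply: contra r2 => /eqP h; rewrite -(@eqrXn2 _ 2) ?ltW //.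
  by apply/eqP; rewrite -[LHS](divfK (_ : 4 != 0)) ?pnatr_eq0 // h; ring.
(* The degenerate case [L = |a1 - a2|] would put a focus on the circle. *)
have s2 : s != 2.
  apply/eqP => s2; have /eqP : (1 - a1 * a1^*) * (1 - a2 * a2^*) = 0.
    by rewrite -[LHS](addKr (`|a1 - a2| ^+ 2)) -L2 LE s2 dE rmorph_nat addNr.
  by rewrite mulf_eq0 !subr_eq0 ![1 == _]eq_sym (negPf n11) (negPf n22).
(* A Poncelet triangle forces [mu], hence [(|f| r)^2 = L^2] with both lengths nonnegative. *)
have uniq D : is_central_conic a1 a2 D -> poncelet_pair 3 (unit_circle R) D ->
    D = focal_conic c f (s ^+ 2 / 4).
  rewrite {1}a1E {1}a2E => /central_conic_focal => /(_ f0) [r [r0 r2 ->]].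
  have [g0 g1] := gE r r0 r2.
  move/(poncelet_focal_mu f0 g0 g1); rewrite muE -a1E -a2E => /eqP.
  rewrite subr_eq [_ + `|_| ^+ 2]addrC -L2.
  have r0' : 0 <= `|f| * r%:C by rewrite ltW // mulr_gt0 // ltcR.
  rewrite (eqrXn2 _ r0' (ltW L0)) // LE => /eqP.
  by move/(mulfI (lt0r_neq0 nf))/complexI ->.
have [g0 g1] := gE s s0 s2.
split.
  exists (focal_conic c f (s ^+ 2 / 4)); split=> [|D [cD pD]]; last by rewrite (uniq D).
  split; first by rewrite a1E a2E; apply/central_conic_focal => //; exists s.
  apply: focal_mu_poncelet; rewrite -?a1E -?a2E //.
  by rewrite muE -LE L2 addrAC subrr add0r.
move=> D cD /(uniq _ cD) DE.
(* By [L2] the sign of [(1 - |a1|^2) (1 - |a2|^2)] decides whether [L] exceeds the focal distance;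
   it is positive exactly when the foci are on the same side of the circle. *)
have lt_dL : (`|a1 - a2| < L) = (2 < s).
  by rewrite dE LE -(rmorph_nat (real_complex R)) ltr_pM2l // ltcR.
have lt_Ld : (L < `|a1 - a2|) = (s < 2).
  by rewrite dE LE -(rmorph_nat (real_complex R)) ltr_pM2l // ltcR.
have sq_lt1 (a : R[i]) : (`|a| < 1) = (0 < 1 - a * a^*).
  by rewrite -norm2 subr_gt0 expr_lt1.
have sq_gt1 (a : R[i]) : (1 < `|a|) = (1 - a * a^* < 0).
  by rewrite -norm2 subr_lt0 expr_gt1.
split; rewrite !sq_lt1 !sq_gt1 => h; rewrite -/L LE {1}a1E {1}a2E.
  apply/ellipse_focal => //; split=> //.
  rewrite -lt_dL -(@ltr_pXn2r _ 2) ?nnegrE ?normr_ge0 ?ltW // L2 ltrDl.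
  by case: h => -[h1 h2]; [rewrite mulr_gt0 | rewrite nmulr_rgt0].
apply/hyperbola_focal => //; split=> //; rewrite s0 -lt_Ld.
rewrite -(@ltr_pXn2r _ 2) ?nnegrE ?normr_ge0 ?(ltW L0) // L2 gtrDl.
by case: h => h1 h2; rewrite pmulr_rlt0.
Qed.
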